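(* Let $\mathbb{K}$ be a field, let $H$ be a positive affine semigroup, let $\mathscr{A}\subseteq H$ be a finite set of generators of $H$, and consider the presentation $\mathbb{K}[F_{\mathscr{A}}]\to\mathbb{K}[H]$, $y^p\mapsto t^{\varphi_{\mathscr{A}}(p)}$, with kernel $I_{\mathscr{A}}$. Then there is a strictly positive weight vector $L=(L_a)_{a\in\mathscr{A}}$ (that is, $L_a\in\mathbb{Q}$ and $L_a>0$ for all $a$) such that $$\mathrm{gr}^L(\mathbb{K}[F_{\mathscr{A}}]/I_{\mathscr{A}})\cong\mathbb{K}[H].$$
   Context: An affine semigroup is a finitely generated, commutative, torsion-free, cancellative monoid; it is positive if $0$ is its only invertible element. $\mathbb{K}[H]=\bigoplus_{h\in H}\mathbb{K}\,t^h$ is the semigroup ring. $F_{\mathscr{A}}=\bigoplus_{a\in\mathscr{A}}\mathbb{N}e_a$ is the free commutative monoid on $\mathscr{A}$, $\varphi_{\mathscr{A}}\colon F_{\mathscr{A}}\to H$ is the monoid map $e_a\mapsto a$, and $\mathbb{K}[F_{\mathscr{A}}]$ is the polynomial ring with monomials $y^p$, $p\in F_{\mathscr{A}}$. A weight vector $L$ defines $\deg_L(\sum_a k_ae_a)=\sum_a k_aL_a$ and the increasing filtration $L_k\mathbb{K}[F_{\mathscr{A}}]=\bigoplus_{\deg_L(p)\le k}\mathbb{K}\,y^p$, $k\in\mathbb{Q}$; the quotient $\mathbb{K}[F_{\mathscr{A}}]/I_{\mathscr{A}}$ carries the image filtration, and $\mathrm{gr}^L$ denotes the associated graded ring $\bigoplus_k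 L_k/L_{<k}$. The isomorphism is one of $\mathbb{K}$-algebras. *)

(* Defs.v *)
From HB Require Import structures.
From mathcomp Require Import all_boot all_order all_algebra.
From mathcomp Require Import finmap ring_quotient.
From mathcomp.classical Require Import boolp classical_sets fsbigop.
From mathcomp Require Import monalg.

Set Implicit Arguments.
Unset Strict Implicit.
Unset Printing Implicit Defensive.

Import Order.TTheory GRing.Theory Num.Theory.
Local Open Scope ring_scope.
Local Open Scope quotient_scope.

Local Notation "1" := (@mone _) : monom_scope.
Local Notation "x * y" := (mmul x y) : monom_scope.

(* Commutative monoids are monalg's [conomType], written multiplicatively: the
   neutral element is [mone] and the sum of h and h' is [mmul h h'].  The
   interface includes the axiom [unitm]: x * y = 1 -> x = 1 /\ y = 1, i.e. the
   neutral element is the only invertible one.  Hence every [conomType] is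
   positive, and positivity is not repeated in [affine_semigroup]. *)

Definition mexp (H : conomType) (h : H) (n : nat) : H := iter n (mmul h) 1%M.

Definition generates (H : conomType) (A : {fset H}) : Prop :=
  forall S : H -> Prop,
    S 1%M -> (forall x y, S x -> S y -> S (x * y)%M) ->
    (forall a, a \in A -> S a) -> forall h, S h.

Record affine_semigroup (H : conomType) : Prop := AffineSemigroup {
  affine_fin_gen : exists A : {fset H}, generates A;
  affine_cancel : forall x : H, injective (mmul x);
  affine_torsion_free :
    forall n, (0 < n)%N -> injective (fun h : H => mexp h n)
}.

Section QuotientAlgebra.
Variables (K : comNzRingType) (R : comAlgType K) (I : idealr R).
Local Notation Q := {ideal_quot I}.

Definition quot_scale (a : K) (x : Q) : Q := \pi_Q (a *: repr x).

Lemma quot_scale_pi a x : quot_scale a (\pi_Q x) = \pi_Q (a *: x).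
Proof.
apply/eqP; rewrite -Quotient.idealrBE -scalerBr -mulr_algl idealMr //.
by rewrite Quotient.idealrBE reprK.
Qed.

Lemma quot_scaleA a b v : quot_scale a (quot_scale b v) = quot_scale (a * b) v.
Proof. by rewrite -[v]reprK; move: (repr v) => x; rewrite (quot_scale_pi b) !quot_scale_pi scalerA. Qed.

Lemma quot_scale1 : left_id 1 quot_scale.
Proof. by move=> v; rewrite -[v]reprK; move: (repr v) => x; rewrite quot_scale_pi scale1r. Qed.

Lemma quot_scaleDr : right_distributive quot_scale +%R.
Proof.
move=> a u v; rewrite -[u]reprK; move: (repr u) => x; rewrite -[v]reprK; move: (repr v) => y.
by rewrite -rmorphD !quot_scale_pi scalerDr rmorphD.
Qed.

Lemma quot_scaleDl v : {morph quot_scale^~ v : a b / a + b}.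
Proof.
move=> a b; rewrite -[v]reprK; move: (repr v) => x.
by rewrite !quot_scale_pi scalerDl rmorphD.
Qed.

HB.instance Definition _ := GRing.Zmodule_isLmodule.Build K Q
  quot_scaleA quot_scale1 quot_scaleDr quot_scaleDl.

Lemma pi_scale (a : K) (x : R) : \pi_Q (a *: x) = a *: \pi_Q x.
Proof. by rewrite [RHS]quot_scale_pi. Qed.

Lemma quot_scaleAl (a : K) (u v : Q) : a *: (u * v) = (a *: u) * v.
Proof.
rewrite -[u]reprK; move: (repr u) => x; rewrite -[v]reprK; move: (repr v) => y.
by rewrite -pi_scale -!rmorphM -pi_scale scalerAl.
Qed.

HB.instance Definition _ := GRing.Lmodule_isLalgebra.Build K Q quot_scaleAl.
HB.instance Definition _ := GRing.Lalgebra_isComAlgebra.Build K Q.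

End QuotientAlgebra.

Section Presentation.
Variables (K : fieldType) (H : conomType) (A : {fset H}).

Definition phiA (p : {cmonom A}) : H :=
  \big[mmul/1%M]_(a : A) mexp (val a) (p a).

Definition tphiA (p : {cmonom A}) : {malg K[H]} := << phiA p >>.

Lemma tphiA_mmorphism : mmorphism tphiA.
Proof.
have mexpD (h : H) m n : mexp h (m + n) = (mexp h m * mexp h n)%M.
  by elim: m => [|m IHm]; rewrite ?mul1m // addSn /= IHm mulmA.
split=> [p q|].
  rewrite [RHS]fgmulUU mulr1 /tphiA; congr << _ >>; rewrite /phiA -big_split /=.
  by apply: eq_bigr => a _; rewrite cmM mexpD.
by congr << _ >>; rewrite /phiA big1 // => a _; rewrite cm1.
Qed.

HB.instance Definition _ :=
  isMultiplicative.Build {cmonom A} {malg K[H]} tphiA tphiA_mmorphism.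

Definition presentation : {malg K[{cmonom A}]} -> {malg K[H]} :=
  mmap (@malgC H K) tphiA.
HB.instance Definition _ := GRing.RMorphism.on presentation.

Definition toric_ideal : {pred {malg K[{cmonom A}]}} :=
  [pred g | presentation g == 0].

Lemma toric_ideal_closed : idealr_closed toric_ideal.
Proof.
split.
- by apply/eqP; apply: (rmorph0 presentation).
- apply/negP => /eqP p1; have /eqP := oner_neq0 {malg K[H]}; apply.
  exact: etrans (esym (rmorph1 presentation)) p1.
- move=> g u v /eqP u0 /eqP v0; apply/eqP.
  apply: etrans (rmorphD presentation _ _) _; rewrite [X in _ + X]v0 addr0.
  by apply: etrans (rmorphM presentation _ _) _; rewrite [X in _ * X]u0 mulr0.
Qed.
HB.instance Definition _ := isIdealr.Build _ toric_ideal toric_ideal_closed.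

End Presentation.
Arguments presentation K {H} A _.
Arguments toric_ideal K {H} A _.

Record filtration (K : fieldType) (R : comAlgType K) := Filtration {
  fil : rat -> {pred R};
  fil_submod : forall k, submod_closed (fil k);
  fil_incr : forall j k, j <= k -> {subset fil j <= fil k};
  fil_1 : 1 \in fil 0;
  fil_M : forall j k x y, x \in fil j -> y \in fil k -> x * y \in fil (j + k)
}.

Section AssociatedGraded.
Variables (K : fieldType) (R : comAlgType K) (F : filtration R).
Implicit Types (i j k : rat) (a : K) (x y : R).

HB.instance Definition _ k := GRing.isSubmodClosed.Build K R (fil F k)
  (GRing.submod_closed_semi (fil_submod F k)).

Record fil_part k := FilPart { fil_val : R; _ : fil_val \in fil F k }.
HB.instance Definition _ k := [isSub for @fil_val k].
HB.instance Definition _ k := [Choice of fil_part k by <:].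
HB.instance Definition _ k := [SubChoice_isSubLmodule of fil_part k by <:].

(* The filtration is increasing, so [F_{<k}] is the union of the [F_j], j < k. *)
Definition fil_lt k : {pred fil_part k} :=
  [pred u | `[< exists2 j, j < k & val u \in fil F j >]].

Lemma fil_lt_submod k : submod_closed (@fil_lt k).
Proof.
split=> [|a u v].
  apply/asboolP; exists (k - 1); first by rewrite ltrBlDr ltrDl.
  by rewrite raddf0 rpred0.
move=> /asboolP[i ik ui] /asboolP[j jk vj]; apply/asboolP.
exists (Num.max i j); first by rewrite gt_max ik.
rewrite linearP rpredD ?rpredZ //.
  by apply: fil_incr ui; rewrite le_max lexx.
by apply: fil_incr vj; rewrite le_max lexx orbT.
Qed.
HB.instance Definition _ k := GRing.isSubmodClosed.Build K (fil_part k)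
  (@fil_lt k) (GRing.submod_closed_semi (fil_lt_submod k)).

Definition gr_part k := Quotient.quot (@fil_lt k).
HB.instance Definition _ k := GRing.Zmodule.on (gr_part k).

Definition gr_cls k (u : fil_part k) : gr_part k := \pi_(gr_part k) u.

Lemma gr_cls_is_additive k : zmod_morphism (@gr_cls k).
Proof. by move=> u v; apply: (raddfB \pi_(Quotient.quot (@fil_lt k))). Qed.
HB.instance Definition _ k :=
  GRing.isZmodMorphism.Build (fil_part k) (gr_part k) (@gr_cls k)
    (@gr_cls_is_additive k).

Lemma gr_clsP k (u v : fil_part k) :
  reflect (gr_cls u = gr_cls v) (u - v \in @fil_lt k).
Proof. by rewrite Quotient.idealrBE; apply: eqP. Qed.

Lemma gr_clsK k (u : gr_part k) : gr_cls (repr u) = u.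
Proof. exact: reprK. Qed.

Definition gr_part_scale k a (u : gr_part k) : gr_part k :=
  gr_cls (a *: repr u).

Lemma gr_part_scale_cls k a (u : fil_part k) :
  gr_part_scale a (gr_cls u) = gr_cls (a *: u).
Proof.
apply/gr_clsP; rewrite -scalerBr rpredZ //.
by apply/gr_clsP; rewrite gr_clsK.
Qed.

Fact gr_part_scaleA k a b (u : gr_part k) :
  gr_part_scale a (gr_part_scale b u) = gr_part_scale (a * b) u.
Proof.
rewrite -[u]gr_clsK; move: (repr u) => {}u.
by rewrite (gr_part_scale_cls b) !gr_part_scale_cls scalerA.
Qed.

Fact gr_part_scale1 k : left_id 1 (@gr_part_scale k).
Proof.
move=> u; rewrite -[u]gr_clsK; move: (repr u) => {}u.
by rewrite gr_part_scale_cls scale1r.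
Qed.

Fact gr_part_scaleDr k : right_distributive (@gr_part_scale k) +%R.
Proof.
move=> a u v; rewrite -[u]gr_clsK -[v]gr_clsK.
move: (repr u) (repr v) => {}u {}v.
by rewrite -raddfD !gr_part_scale_cls scalerDr raddfD.
Qed.

Fact gr_part_scaleDl k (u : gr_part k) :
  {morph (@gr_part_scale k)^~ u : a b / a + b}.
Proof.
move=> a b; rewrite -[u]gr_clsK; move: (repr u) => {}u.
by rewrite !gr_part_scale_cls scalerDl raddfD.
Qed.

HB.instance Definition _ k := GRing.Zmodule_isLmodule.Build K (gr_part k)
  (@gr_part_scaleA k) (@gr_part_scale1 k) (@gr_part_scaleDr k)
  (@gr_part_scaleDl k).

Lemma gr_clsZ k a (u : fil_part k) : gr_cls (a *: u) = a *: gr_cls u.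
Proof. by rewrite [RHS]gr_part_scale_cls. Qed.

Definition fil_part_mul i j (u : fil_part i) (v : fil_part j) :
  fil_part (i + j) := FilPart (fil_M (valP u) (valP v)).

Definition gr_part_mul i j (u : gr_part i) (v : gr_part j) : gr_part (i + j) :=
  gr_cls (fil_part_mul (repr u) (repr v)).

Lemma gr_part_mul_cls i j (u : fil_part i) (v : fil_part j) :
  gr_part_mul (gr_cls u) (gr_cls v) = gr_cls (fil_part_mul u v).
Proof.
have /gr_clsP := gr_clsK (gr_cls u); have /gr_clsP := gr_clsK (gr_cls v).
rewrite /gr_part_mul; move: (repr (gr_cls u)) (repr (gr_cls v)) => u' v'.
case/asboolP=> q qj vq /asboolP[p pi up].
apply/gr_clsP/asboolP; exists (Num.max (p + j) (i + q)).
  by rewrite gt_max ltrD2r pi ltrD2l qj.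
rewrite raddfB /=.
have -> : val u' * val v' - val u * val v
    = val (u' - u) * val v' + val u * val (v' - v).
  by rewrite !raddfB /= mulrBl mulrBr addrA subrK.
apply: rpredD.
  apply: (@fil_incr _ _ F (p + j)); first by rewrite le_max lexx.
  exact: fil_M up (valP v').
apply: (@fil_incr _ _ F (i + q)); first by rewrite le_max lexx orbT.
exact: fil_M (valP u) vq.
Qed.

Lemma gr_part_mulDl i j (u u' : gr_part i) (v : gr_part j) :
  gr_part_mul (u + u') v = gr_part_mul u v + gr_part_mul u' v.
Proof.
rewrite -[u]gr_clsK -[u']gr_clsK -[v]gr_clsK -raddfD !gr_part_mul_cls -raddfD.
by congr gr_cls; apply: val_inj; apply: mulrDl.
Qed.

Lemma gr_part_mulDr i j (u : gr_part i) (v v' : gr_part j) :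
  gr_part_mul u (v + v') = gr_part_mul u v + gr_part_mul u v'.
Proof.
rewrite -[u]gr_clsK -[v']gr_clsK -[v]gr_clsK -raddfD !gr_part_mul_cls -raddfD.
by congr gr_cls; apply: val_inj; apply: mulrDr.
Qed.

Lemma gr_part_mul0l i j (v : gr_part j) : gr_part_mul (0 : gr_part i) v = 0.
Proof. by apply: (addIr (gr_part_mul 0 v)); rewrite -gr_part_mulDl !add0r. Qed.

Lemma gr_part_mul0r i j (u : gr_part i) : gr_part_mul u (0 : gr_part j) = 0.
Proof. by apply: (addIr (gr_part_mul u 0)); rewrite -gr_part_mulDr !add0r. Qed.

Lemma gr_part_mulZl i j a (u : gr_part i) (v : gr_part j) :
  gr_part_mul (a *: u) v = a *: gr_part_mul u v.
Proof.
rewrite -[u]gr_clsK -[v]gr_clsK -gr_clsZ !gr_part_mul_cls -gr_clsZ.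
by congr gr_cls; apply: val_inj; rewrite /= -scalerAl.
Qed.

Record gr := Gr {
  gr_comp :> forall k, gr_part k;
  gr_finite : exists s : {fset rat}, forall k, k \notin s -> gr_comp k = 0
}.

Implicit Types f g h : gr.

HB.instance Definition _ := gen_eqMixin gr.
HB.instance Definition _ := gen_choiceMixin gr.

Lemma grP (f g : gr) : (forall k, f k = g k) -> f = g.
Proof.
case: f g => [f hf] [g hg] /= fg.
have {}fg : f = g by apply: functional_extensionality_dep.
by case: _ / fg hg => hg; congr Gr; apply: Prop_irrelevance.
Qed.

Fact gr_zero_finite :
  exists s : {fset rat}, forall k, k \notin s -> 0 = 0 :> gr_part k.
Proof. by exists fset0. Qed.
Definition gr_zero := Gr gr_zero_finite.

Fact gr_add_finite (f g : gr) :
  exists s : {fset rat}, forall k, k \notin s -> f k + g k = 0.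
Proof.
have [[s fs] [t gt]] := (gr_finite f, gr_finite g).
exists (s `|` t)%fset => k; rewrite in_fsetU negb_or => /andP[ks kt].
by rewrite fs // gt // addr0.
Qed.
Definition gr_add f g := Gr (gr_add_finite f g).

Fact gr_opp_finite (f : gr) :
  exists s : {fset rat}, forall k, k \notin s -> - f k = 0.
Proof.
by have [s fs] := gr_finite f; exists s => k ks; rewrite fs // oppr0.
Qed.
Definition gr_opp f := Gr (gr_opp_finite f).

Fact gr_addA : associative gr_add.
Proof. by move=> f g h; apply: grP => k; apply: addrA. Qed.
Fact gr_addC : commutative gr_add.
Proof. by move=> f g; apply: grP => k; apply: addrC. Qed.
Fact gr_add0 : left_id gr_zero gr_add.
Proof. by move=> f; apply: grP => k; apply: add0r. Qed.
Fact gr_addN : left_inverse gr_zero gr_opp gr_add.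
Proof. by move=> f; apply: grP => k; apply: addNr. Qed.
HB.instance Definition _ :=
  GRing.isZmodule.Build gr gr_addA gr_addC gr_add0 gr_addN.

Fact gr_scale_finite a (f : gr) :
  exists s : {fset rat}, forall k, k \notin s -> a *: f k = 0.
Proof.
by have [s fs] := gr_finite f; exists s => k ks; rewrite fs // scaler0.
Qed.
Definition gr_scale a f := Gr (gr_scale_finite a f).

Fact gr_scaleA a b f : gr_scale a (gr_scale b f) = gr_scale (a * b) f.
Proof. by apply: grP => k; apply: scalerA. Qed.
Fact gr_scale1 : left_id 1 gr_scale.
Proof. by move=> f; apply: grP => k; apply: scale1r. Qed.
Fact gr_scaleDr : right_distributive gr_scale +%R.
Proof. by move=> a f g; apply: grP => k; apply: scalerDr. Qed.
Fact gr_scaleDl f : {morph gr_scale^~ f : a b / a + b}.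
Proof. by move=> a b; apply: grP => k; apply: scalerDl. Qed.
HB.instance Definition _ := GRing.Zmodule_isLmodule.Build K gr
  gr_scaleA gr_scale1 gr_scaleDr gr_scaleDl.

Lemma gr_compD (f g : gr) k : (f + g : gr) k = f k + g k. Proof. by []. Qed.
Lemma gr_compZ a (f : gr) k : (a *: f : gr) k = a *: f k. Proof. by []. Qed.
Lemma gr_comp0 k : (0 : gr) k = 0. Proof. by []. Qed.

Fact gr_in_finite k (u : gr_part k) : exists s : {fset rat},
  forall l, l \notin s -> dfwith (fun l => 0 : gr_part l) u l = 0.
Proof.
exists [fset k]%fset => l; rewrite in_fset1 => lk.
by rewrite dfwith_out // eq_sym.
Qed.
Definition gr_in k (u : gr_part k) : gr := Gr (gr_in_finite u).

Lemma gr_inE k (u : gr_part k) : gr_in u k = u.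
Proof. exact: dfwith_in. Qed.

Lemma gr_in_out k l (u : gr_part k) : k != l -> gr_in u l = 0.
Proof. by move=> kl; rewrite /= dfwith_out. Qed.

Lemma gr_inD k : {morph @gr_in k : u v / u + v}.
Proof.
move=> u v; apply: grP => l; rewrite gr_compD.
by have [<-|kl] := eqVneq k l; rewrite ?gr_inE // !gr_in_out // addr0.
Qed.

Lemma gr_in0 k : gr_in (0 : gr_part k) = 0.
Proof. by apply: (addIr (gr_in (0 : gr_part k))); rewrite -gr_inD !add0r. Qed.

Lemma gr_inZ k a (u : gr_part k) : gr_in (a *: u) = a *: gr_in u.
Proof.
apply: grP => l; rewrite gr_compZ.
by have [<-|kl] := eqVneq k l; rewrite ?gr_inE // !gr_in_out // scaler0.
Qed.

Lemma gr_in_eq k l (u : fil_part k) (v : fil_part l) :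
  k = l -> val u = val v -> gr_in (gr_cls u) = gr_in (gr_cls v).
Proof. by move=> kl; case: _ / kl v => v /val_inj->. Qed.

Lemma gr_sum_in f : f = \sum_(k \in [set: rat]) gr_in (f k).
Proof.
have [s fs] := gr_finite f.
rewrite (fsbigTE s) => [|k /fs->]; last exact: gr_in0.
apply: grP => k.
rewrite (big_morph (fun g : gr => g k) (id1 := 0) (op1 := +%R)) //.
have [ks|/[dup] ks /fs->] := boolP (k \in s).
  rewrite (big_fsetD1 k) // gr_inE big_seq big1 /= ?addr0 // => l.
  by rewrite in_fsetD1 => /andP[lk _]; apply: (@gr_in_out l k).
rewrite big_seq big1 // => l ls; rewrite gr_in_out //.
by apply: contraNneq ks => <-.
Qed.

Lemma gr_ind (P : gr -> Prop) :
  P 0 -> (forall f g, P f -> P g -> P (f + g)) ->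
  (forall k (u : fil_part k), P (gr_in (gr_cls u))) -> forall f, P f.
Proof.
move=> P0 PD Pin f; rewrite (gr_sum_in f); have [s fs] := gr_finite f.
rewrite (fsbigTE s) => [|k /fs->]; last exact: gr_in0.
by elim/big_ind: _ => // k _; rewrite -[f k]gr_clsK.
Qed.

Definition gr_one : gr := gr_in (gr_cls (FilPart (fil_1 F))).

(* Bilinear extension of [gr_part_mul]; the sums are finite because f and g have
   finite support. *)
Definition gr_mul (f g : gr) : gr :=
  \sum_(i \in [set: rat]) \sum_(j \in [set: rat])
    gr_in (gr_part_mul (f i) (g j)).

Lemma gr_mulE (s t : {fset rat}) f g :
  (forall k, k \notin s -> f k = 0) -> (forall k, k \notin t -> g k = 0) ->
  gr_mul f g = \sum_(i <- s) \sum_(j <- t) gr_in (gr_part_mul (f i) (g j)).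
Proof.
move=> fs gt; rewrite /gr_mul (fsbigTE s) => [|i /fs->].
  apply: eq_bigr => i _; rewrite (fsbigTE t) // => j /gt->.
  by rewrite gr_part_mul0r gr_in0.
by rewrite fsbig1 // => j _; rewrite gr_part_mul0l gr_in0.
Qed.

Lemma gr_finite2 f g : exists s : {fset rat},
  (forall k, k \notin s -> f k = 0) /\ (forall k, k \notin s -> g k = 0).
Proof.
have [[s fs] [t gt]] := (gr_finite f, gr_finite g).
exists (s `|` t)%fset; split=> k; rewrite in_fsetU negb_or => /andP[ks kt].
  exact: fs.
exact: gt.
Qed.

Lemma gr_mul_in i j (u : gr_part i) (v : gr_part j) :
  gr_mul (gr_in u) (gr_in v) = gr_in (gr_part_mul u v).
Proof.
rewrite (@gr_mulE [fset i]%fset [fset j]%fset) => [|k|k].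
- by rewrite !big_seq_fset1 !gr_inE.
- by rewrite in_fset1 => ki; rewrite gr_in_out // eq_sym.
- by rewrite in_fset1 => ki; rewrite gr_in_out // eq_sym.
Qed.

Fact gr_mulC : commutative gr_mul.
Proof.
move=> f g; have [s [fs gs]] := gr_finite2 f g.
rewrite (gr_mulE fs gs) (gr_mulE gs fs) exchange_big.
apply: eq_bigr => j _; apply: eq_bigr => i _.
rewrite -[f i]gr_clsK -[g j]gr_clsK !gr_part_mul_cls.
by apply: gr_in_eq; [apply: addrC | apply: mulrC].
Qed.

Fact gr_mulDl : left_distributive gr_mul +%R.
Proof.
move=> f f' g; have [s [fs f's]] := gr_finite2 f f'.
have [t gt] := gr_finite g.
rewrite (gr_mulE fs gt) (gr_mulE f's gt) (@gr_mulE s t (f + f')) //.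
  rewrite -big_split; apply: eq_bigr => i _.
  rewrite -big_split; apply: eq_bigr => j _.
  by rewrite gr_compD gr_part_mulDl gr_inD.
by move=> k ks; rewrite gr_compD fs // f's // addr0.
Qed.

Fact gr_mulDr : right_distributive gr_mul +%R.
Proof. by move=> f g h; rewrite gr_mulC gr_mulDl !(gr_mulC f). Qed.

Lemma gr_mul0 f : gr_mul 0 f = 0.
Proof. by apply: (addIr (gr_mul 0 f)); rewrite -gr_mulDl !add0r. Qed.

Fact gr_mul1 : left_id gr_one gr_mul.
Proof.
elim/gr_ind => [|f g IHf IHg|k u].
- by rewrite gr_mulC gr_mul0.
- by rewrite gr_mulDr IHf IHg.
rewrite gr_mul_in gr_part_mul_cls.
by apply: gr_in_eq; [apply: add0r | apply: mul1r].
Qed.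

Fact gr_mulA : associative gr_mul.
Proof.
elim/gr_ind => [g h|f f' IHf IHf' g h|i u].
- by rewrite !gr_mul0.
- by rewrite !gr_mulDl IHf IHf'.
elim/gr_ind => [h|g g' IHg IHg' h|j v].
- by rewrite [gr_mul _ 0]gr_mulC !gr_mul0 gr_mulC gr_mul0.
- by rewrite gr_mulDl !gr_mulDr gr_mulDl IHg IHg'.
elim/gr_ind => [|h h' IHh IHh'|k w].
- by rewrite !(gr_mulC _ 0) !gr_mul0 gr_mulC gr_mul0.
- by rewrite !gr_mulDr IHh IHh'.
rewrite !gr_mul_in !gr_part_mul_cls.
by apply: gr_in_eq; [apply: addrA | apply: mulrA].
Qed.

(* For an arbitrary filtration 1 may lie in [F_{<0}], and then [gr] is the zero
   ring, so it is not an instance of [lalgType], whose rings are nontrivial.  Its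
   K-algebra structure consists of the [lmodType], the [comPzRingType] and the
   compatibility [gr_scaleAl]. *)
HB.instance Definition _ :=
  GRing.Zmodule_isComPzRing.Build gr gr_mulA gr_mulC gr_mul1 gr_mulDl.

Lemma gr_scaleAl a (f g : gr) : a *: (f * g) = (a *: f) * g.
Proof.
have [[s fs] [t gt]] := (gr_finite f, gr_finite g).
rewrite [f * g](gr_mulE fs gt) [_ * g](@gr_mulE s t) //.
  rewrite scaler_sumr; apply: eq_bigr => i _.
  rewrite scaler_sumr; apply: eq_bigr => j _.
  by rewrite gr_compZ gr_part_mulZl gr_inZ.
by move=> k ks; rewrite gr_compZ fs // scaler0.
Qed.

End AssociatedGraded.

Section QuotientFiltration.
Variables (K : fieldType) (R : comAlgType K) (I : idealr R) (F : filtration R).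
Local Notation Q := {ideal_quot I}.

Definition quot_fil (k : rat) : {pred Q} :=
  [pred u | `[< exists2 x, x \in fil F k & \pi_Q x = u >]].

Fact quot_fil_submod k : submod_closed (quot_fil k).
Proof.
split=> [|a _ _ /asboolP[x xF <-] /asboolP[y yF <-]]; apply/asboolP.
  by exists 0; [apply: rpred0 | apply: raddf0].
exists (a *: x + y); first by rewrite rpredD ?rpredZ.
by rewrite -pi_scale -raddfD.
Qed.

Fact quot_fil_incr j k : j <= k -> {subset quot_fil j <= quot_fil k}.
Proof.
move=> jk _ /asboolP[x xF <-]; apply/asboolP; exists x => //.
exact: fil_incr jk _ xF.
Qed.

Fact quot_fil_1 : 1 \in quot_fil 0.
Proof. by apply/asboolP; exists 1; [apply: fil_1 | apply: rmorph1]. Qed.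

Fact quot_fil_M j k (u v : Q) :
  u \in quot_fil j -> v \in quot_fil k -> u * v \in quot_fil (j + k).
Proof.
move=> /asboolP[x xF <-] /asboolP[y yF <-]; apply/asboolP; exists (x * y).
  exact: fil_M.
exact: rmorphM.
Qed.

Definition quot_filtration : filtration Q :=
  Filtration quot_fil_submod quot_fil_incr quot_fil_1 quot_fil_M.

End QuotientFiltration.

Section WeightFiltration.
Variables (K : fieldType) (H : conomType) (A : {fset H}) (L : A -> rat).
Local Notation S := {malg K[{cmonom A}]}.

Definition wdeg (p : {cmonom A}) : rat := \sum_(a : A) L a *+ p a.

Lemma wdeg1 : wdeg 1%M = 0.
Proof. by rewrite /wdeg big1 // => a _; rewrite cm1. Qed.

Lemma wdegM p q : wdeg (p * q)%M = wdeg p + wdeg q.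
Proof.
by rewrite /wdeg -big_split; apply: eq_bigr => a _; rewrite cmM mulrnDr.
Qed.

Definition weight_fil (k : rat) : {pred S} :=
  [pred g : S | all (fun p => wdeg p <= k) (msupp g)].

Fact weight_fil_submod k : submod_closed (weight_fil k).
Proof.
split=> [|c g h /allP gk /allP hk]; first by rewrite inE msupp0.
apply/allP => p /(fsubsetP (msuppD_le _ _)); rewrite in_fsetU.
by case/orP=> [/(fsubsetP (msuppZ_le _ _))/gk|/hk].
Qed.

Fact weight_fil_incr j k : j <= k -> {subset weight_fil j <= weight_fil k}.
Proof. by move=> jk g /allP gj; apply/allP => p /gj/le_trans; apply. Qed.

Fact weight_fil_1 : 1 \in weight_fil 0.
Proof.
by apply/allP => p; rewrite msuppU1 in_fset1 => /eqP->; rewrite wdeg1.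
Qed.

Fact weight_fil_M j k (g h : S) :
  g \in weight_fil j -> h \in weight_fil k -> g * h \in weight_fil (j + k).
Proof.
move=> /allP gj /allP hk; apply/allP => r /msuppM_le[p [q [/gj pj /hk qk ->]]].
by rewrite wdegM lerD.
Qed.

Definition weight_filtration : filtration S :=
  Filtration weight_fil_submod weight_fil_incr weight_fil_1 weight_fil_M.

End WeightFiltration.
Arguments weight_filtration K {H A} L.

(* Main.v *)
(** By cancellation and the absence of nontrivial units, no nontrivial
   nonnegative combination of the generators other than 1 vanishes in the group
   of H.  By Gordan's theorem there is an additive [ell : H -> rat] which is
   positive on these generators.  Give [a <> 1] the weight [ell a] and, should 1
   be a generator, give it the weight 1.  Then the weight of a monomial [y^p] is
   at least [ell (phi p)], with equality for some monomial over each element of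
   H, so that the quotient filtration is the filtration of K[H] by the grading
   [ell], and its associated graded ring is K[H]. *)

From HB Require Import structures.
Require Import Defs.
From mathcomp Require Import all_boot all_order all_algebra.
From mathcomp Require Import finmap ring_quotient monalg.
From mathcomp.classical Require Import boolp classical_sets fsbigop.
From mathcomp Require Import lra.

Set Implicit Arguments.
Unset Strict Implicit.
Unset Printing Implicit Defensive.

Import Order.TTheory GRing.Theory Num.Theory.
Local Open Scope ring_scope.

(** * Gordan's theorem over an ordered field *)

(** This supplies the eliminated coordinate in [gordan]. A point found for the earlier lower bounds
    is kept unless the new bound reaches it; then a point just above the new bound serves for all of
    them. *)
Lemma exists_between (R : realFieldType) (l u : seq R) :
  {in l & u, forall x y, x < y} ->
  exists t, {in l, forall x, x < t} /\ {in u, forall y, t < y}.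
Proof.
have above x : {in u, forall y, x < y} ->
    exists2 t, x < t & {in u, forall y, t < y}.
  elim: u => [_|y u IHu xu]; first by exists (x + 1) => //; rewrite ltrDl.
  have [z zu|t xt tu] := IHu; first by rewrite xu // inE zu orbT.
  have xy : x < y by rewrite xu // mem_head.
  exists (Num.min t ((x + y) / 2)); first by rewrite lt_min xt midf_lt.
  move=> z; rewrite inE gt_min => /predU1P[->|/tu->//].
  by rewrite (midf_lt xy) orbT.
elim: l => [_|x l IHl lu].
  elim: {above} u => [|y u [t [_ tu]]]; first by exists 0.
  exists (Num.min t (y - 1)); split=> // z; rewrite inE gt_min.
  by case/predU1P=> [->|/tu->//]; rewrite gtrBl ltr01 orbT.
have [y z yl zu|t [lt tu]] := IHl; first by rewrite lu // inE yl orbT.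
have [tx|xt] := leP t x; last first.
  by exists t; split=> // y; rewrite inE => /predU1P[->|/lt].
have [y yu|t' xt' t'u] := above x; first by rewrite lu // mem_head.
exists t'; split=> // y; rewrite inE => /predU1P[->//|/lt yt].
exact: lt_trans (lt_le_trans yt tx) xt'.
Qed.

(* Fourier-Motzkin elimination of the first coordinate; membership in the convex
   cone [P] replaces the bookkeeping of the nonnegative combinations. *)
Lemma gordan (R : realFieldType) d (s : seq 'rV[R]_d) (P : 'rV[R]_d -> Prop) :
  (forall u v, P u -> P v -> P (u + v)) ->
  (forall k v, 0 < k -> P v -> P (k *: v)) ->
  ~ P 0 -> {in s, forall v, P v} ->
  exists c : 'cV[R]_d, {in s, forall v, 0 < (v *m c) 0 0}.
Proof.
elim: d => [|d IHd] in s P * => PD PZ P0 sP.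
  exists 0 => v /sP; have -> : v = 0 by apply/matrixP => i [].
  by move/P0.
pose hd (v : 'rV[R]_d.+1) := lsubmx (v : 'rV_(1 + d)) 0 0.
pose tl (v : 'rV[R]_d.+1) := rsubmx (v : 'rV_(1 + d)).
have rowE v : v = row_mx (hd v)%:M (tl v).
  by rewrite -[LHS](@hsubmxK _ 1 1 d) -mx11_scalar.
pose s0 := [seq tl v | v <- s & hd v == 0].
(* For [hd u < 0 < hd v] this is the tail of the positive combination of [v] and [u] whose first
   coordinate cancels. *)
pose elim2 v u := (- hd u) *: tl v + hd v *: tl u.
pose s1 := [seq elim2 v u | v <- [seq v <- s | 0 < hd v],
                            u <- [seq u <- s | hd u < 0]].
have [||||c cP] := IHd (s0 ++ s1) (fun w => P (row_mx (0 : 'M_1) w)).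
- move=> u v Pu Pv; have := PD _ _ Pu Pv.
  by rewrite (@add_row_mx _ 1 1 d) addr0.
- move=> k v k0 Pv; have := PZ _ _ k0 Pv.
  by rewrite (@scale_row_mx _ 1 1 d) scaler0.
- by rewrite row_mx0.
- move=> w; rewrite mem_cat => /orP[/mapP[v]|/allpairsP[[v u]] /=].
    rewrite mem_filter => /andP[/eqP v0 vs] ->.
    by have := sP v vs; rewrite [v in P v]rowE v0 scalar_mx_is_nmod_morphism.
  rewrite !mem_filter => -[/andP[v0 vs] /andP[u0 us] ->].
  have nu0 : 0 < - hd u by rewrite oppr_gt0.
  have := PD _ _ (PZ _ _ nu0 (sP v vs)) (PZ _ _ v0 (sP u us)).
  rewrite [X in _ *: X + _]rowE [X in _ + _ *: X]rowE.
  rewrite !(@scale_row_mx _ 1 1 d) (@add_row_mx _ 1 1 d).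
  by rewrite !scale_scalar_mx -raddfD /= mulNr mulrC addNr raddf0.
pose g v := (tl v *m c) 0 0.
(* The condition [0 < hd v * t + g v] bounds [t] from below or above according to the sign of
   [hd v]. Positivity of [c] on [elim2 v u] says that each lower bound is below each upper bound. *)
have [|t [tl_t t_tu]] := @exists_between R
    [seq - (g v / hd v) | v <- s & 0 < hd v]
    [seq - (g u / hd u) | u <- s & hd u < 0].
  move=> _ _ /mapP[v vs ->] /mapP[u us ->].
  have := cP (elim2 v u); rewrite mem_cat (allpairs_f elim2) // orbT.
  move/(_ isT).
  rewrite mulmxDl -!scalemxAl mxE [X in X + _]mxE [X in _ + X]mxE.
  rewrite -/(g v) -/(g u); move: vs us; rewrite !mem_filter.
  move=> /andP[v0 _] /andP[u0 _] gvu.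
  rewrite ltrN2 ltr_ndivrMr // mulrAC ltr_pdivrMr //. lra.
exists (col_mx t%:M c) => v vs.
have -> : (v *m col_mx t%:M c) 0 0 = hd v * t + g v.
  rewrite {1}[v]rowE (@mul_row_col _ 1 1 d) -scalar_mxM mxE.
  by rewrite [X in X + _]mxE mulr1n.
have [v0|v0|v0] := ltgtP (hd v) 0.
- have vs' : v \in [seq u <- s | hd u < 0] by rewrite mem_filter v0.
  have := t_tu _ (map_f _ vs'); rewrite ltrNr ltr_ndivrMr //; lra.
- have vs' : v \in [seq v <- s | 0 < hd v] by rewrite mem_filter v0.
  have := tl_t _ (map_f _ vs'); rewrite ltrNl ltr_pdivlMr //; lra.
- rewrite v0 mul0r add0r; apply: cP; rewrite mem_cat map_f //.
  by rewrite mem_filter v0 eqxx.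
Qed.

(** Take [M] of maximal rank among the matrices with row space inside [V]: adjoining a vector of [V]
    outside that row space would raise the rank. *)
Lemma subspace_rowspace (F : fieldType) n (V : 'rV[F]_n -> Prop) :
  V 0 -> (forall c u v, V u -> V v -> V (c *: u + v)) ->
  exists M : 'M[F]_n, forall v, V v <-> (v <= M)%MS.
Proof.
move=> V0 Vlin.
pose Q k :=
  `[< exists2 M : 'M[F]_n, forall v, (v <= M)%MS -> V v & \rank M = k >].
have exQ : exists k, Q k.
  exists 0%N; apply/asboolP; exists 0; last exact: mxrank0.
  by move=> v; rewrite submx0 => /eqP->.
have ubQ k : Q k -> (k <= n)%N by case/asboolP=> M _ <-; exact: rank_leq_row.
case: (ex_maxnP exQ ubQ) => _ /asboolP[M MV <-] Mmax.
exists M => v; split=> [Vv|]; last exact: MV.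
apply: contraT => vM.
have : Q (\rank (M + v)%MS).
  apply/asboolP; exists (M + v)%MS => // w /sub_addsmxP[[D E] -> /=].
  rewrite (mx11_scalar E) mul_scalar_mx addrC; apply: Vlin => //.
  exact/MV/submxMl.
move/Mmax; rewrite leqNgt => /negP[].
have: (M < M + v)%MS.
  by rewrite /ltmx addsmxSl addsmx_sub submx_refl.
by rewrite ltmxErank => /andP[].
Qed.

(** * A positive grading of the semigroup *)

Section AffineSemigroup.
Variables (H : conomType) (A : {fset H}).
Implicit Types p q : {cmonom A}.

Lemma mexpD (h : H) m n : mexp h (m + n) = mmul (mexp h m) (mexp h n).
Proof. by elim: m => [|m IHm]; rewrite ?mul1m // addSn /= IHm mulmA. Qed.

Lemma phiA1 : phiA (mone : {cmonom A}) = mone.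
Proof. by rewrite /phiA big1 // => a _; rewrite cm1. Qed.

Lemma phiAM p q : phiA (mmul p q) = mmul (phiA p) (phiA q).
Proof.
by rewrite /phiA -big_split; apply: eq_bigr => a _; rewrite cmM mexpD.
Qed.

Lemma phiAU (a : A) : phiA (ucm a) = val a.
Proof.
rewrite /phiA (bigD1 a) //= cmUU /= mulm1 big1 ?mulm1 // => b ba.
by rewrite cmU eq_sym (negPf ba).
Qed.

(** Positivity, through [unitm]: every factor of a product equal to 1 is 1. *)
Lemma phiA_eq1 p : phiA p = mone -> forall a, p a = 0%N \/ val a = mone.
Proof.
rewrite /phiA => p1 a; move: p1; rewrite (bigD1 a) //= => /unitm[+ _].
by case: (p a) => [|n]; [left | move=> /= /unitm[-> _]; right].
Qed.

Lemma phiA_surj (h : H) : generates A ->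
  exists p, phiA p = h /\ forall a, val a = mone -> p a = 0%N.
Proof.
move/(_ (fun h => exists p, phiA p = h /\ forall a, val a = mone -> p a = 0%N)).
apply=> [|x y [p [<- p0]] [q [<- q0]]|a aA].
- by exists mone; rewrite phiA1; split=> // a _; rewrite cm1.
- exists (mmul p q); rewrite phiAM; split=> // a a1.
  by rewrite cmM p0 // q0.
have [->|a1] := eqVneq a mone.
  by exists mone; rewrite phiA1; split=> // b _; rewrite cm1.
exists (ucm [` aA]%fset); rewrite phiAU; split=> // b b1.
by rewrite cmU; case: eqP => // ab; move: a1; rewrite -b1 -ab eqxx.
Qed.

(** A linear form on exponent vectors that kills all differences [vec p - vec q] with
    [phiA p = phiA q] depends only on [phiA p]. Gordan's theorem in the quotient by these
    differences makes it positive on the nontrivial generators. *)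
Lemma positive_grading : (forall x : H, injective (mmul x)) ->
  exists ell : A -> rat, (forall a : A, val a != mone -> 0 < ell a) /\
    forall p q, phiA p = phiA q -> wdeg ell p = wdeg ell q.
Proof.
move=> Hcancel.
pose n := #|{: A}|.
pose vec p : 'rV[rat]_n := \row_i (p (enum_val i))%:R.
have vecM p q : vec (mmul p q) = vec p + vec q.
  by apply/rowP => i; rewrite !mxE cmM natrD.
have vec1 : vec mone = 0 by apply/rowP => i; rewrite !mxE cm1.
pose rel r := exists p q, phiA p = phiA q /\ r = vec p - vec q.
have rel0 : rel 0 by exists mone, mone; rewrite subrr.
have relB r r' : rel r -> rel r' -> rel (r - r').
  move=> [p [q [pq ->]]] [p' [q' [pq' ->]]].
  exists (mmul p q'), (mmul q p'); rewrite !phiAM pq pq'; split=> //.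
  by rewrite !vecM opprB opprD addrACA.
have relD r r' : rel r -> rel r' -> rel (r + r').
  move=> rr rr'; rewrite -[r']opprK -[- r']sub0r.
  by apply: (relB) => //; apply: (relB).
have relZ r (z : int) : rel r -> rel (r *~ z).
  move=> rr; have relMn m : rel (r *+ m).
    by elim: m => [|m IHm]; rewrite ?mulr0n // mulrS; apply: relD.
  case: z => m; first exact: relMn.
  by rewrite NegzE mulrNz -sub0r; apply: (relB) => //; apply: relMn.
(* The rational span of the relation lattice [rel]. *)
pose V r := exists2 z : int, 0 < z & rel (r *~ z).
have [||M MV] := @subspace_rowspace _ n V.
- by exists 1 => //; rewrite mul0rz.
- move=> c u v [y y0 uy] [z z0 vz].
  (* The factor [denq c] turns [c] into the integer [numq c]; [y] and [z] clear the denominators of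
     [u] and [v]. *)
  exists (denq c * (y * z)); first by rewrite !mulr_gt0 ?denq_gt0.
  have -> : (c *: u + v) *~ (denq c * (y * z))
      = (u *~ y) *~ (numq c * z) + (v *~ z) *~ (denq c * y).
    rewrite -!scaler_int scalerDr !scalerA; congr (_ *: _ + _ *: _).
      by rewrite !intrM numqE; lra.
    by rewrite !intrM; lra.
  by apply: (relD); apply: (relZ).
(* The linear forms vanishing on all relations are the combinations [N *m c] of
   the columns of [N]. *)
pose N := cokermx M.
pose P w := exists p : 'rV[rat]_n, [/\ forall i, 0 <= p 0 i,
  exists2 i, val (enum_val i) != mone & 0 < p 0 i & w = p *m N].
have [|||v /mapP[i + ->{v}]|c cP] := @gordan _ _
    [seq row i N | i <- enum 'I_n & val (enum_val i) != mone] P.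
- move=> _ _ [p [p0 [i i1 pi] ->]] [q [q0 _ ->]]; exists (p + q).
  split=> [j||]; rewrite ?mulmxDl // ?mxE ?addr_ge0 //.
  by exists i => //; rewrite mxE ltr_pwDl.
- move=> k _ k0 [p [p0 [i i1 pi] ->]]; exists (k *: p).
  split=> [j||]; rewrite ?scalemxAl // ?mxE ?mulr_ge0 // ?ltW //.
  by exists i => //; rewrite mxE mulr_gt0.
(* If [p *m N = 0], a positive multiple of [p] is [vec a - vec b] with [phiA a = phiA b]. As [p] is
   nonnegative, [b] divides [a]; cancellation gives [phiA (divcm a b) = mone], which contradicts
   positivity at the nontrivial generator of index [i]. *)
- move=> [p [p0 [i i1 pi] /esym/eqP]]; rewrite -submxE => /MV[z z0].
  move=> [a [b [ab pab]]].
  have pabj (j : 'I_n) :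
      (a (enum_val j))%:R = p 0 j * z%:~R + (b (enum_val j))%:R.
    move/rowP: pab => /(_ j); rewrite -scaler_int !mxE => /eqP.
    by rewrite eq_sym subr_eq mulrC => /eqP.
  have ba (j : 'I_n) : (b (enum_val j) <= a (enum_val j))%N.
    by rewrite -(ler_nat rat) [leRHS]pabj lerDr mulr_ge0 // ler0z ltW.
  have aE : a = mmul b (divcm a b).
    apply/eqP/cmP => x; rewrite cmM divcmE -[x]enum_rankK.
    by rewrite subnKC // ba.
  move: ab; rewrite [in LHS]aE phiAM -[RHS]mulm1 => /Hcancel/phiA_eq1.
  move=> /(_ (enum_val i))[/eqP|/eqP]; apply/negP => //.
  rewrite divcmE subn_eq0 -ltnNge -(ltr_nat rat) [ltRHS]pabj ltrDr.
  by rewrite mulr_gt0 // ltr0z.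
- rewrite mem_filter => /andP[i1 _]; exists (delta_mx 0 i).
  split=> [j||]; rewrite ?rowE // ?mxE ?ler0n //.
  by exists i => //; rewrite mxE !eqxx.
exists (fun a => (N *m c) (enum_rank a) 0); split=> [a a1|p q pq].
  have := cP (row (enum_rank a) N); rewrite -row_mul mxE; apply.
  by apply: map_f; rewrite mem_filter mem_enum enum_rankK a1.
have wdegE p' : wdeg (fun a => (N *m c) (enum_rank a) 0) p'
    = (vec p' *m (N *m c)) 0 0.
  rewrite /wdeg mxE (reindex _ (onW_bij _ (enum_val_bij _))) /=.
  by apply: eq_bigr => i _; rewrite enum_valK [X in _ = X * _]mxE mulr_natl.
rewrite !wdegE; apply/eqP; rewrite -subr_eq0; apply/eqP.
have : (vec p - vec q <= M)%MS by apply/MV; exists 1 => //; exists p, q.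
rewrite submxE => /eqP MN; have := congr1 (fun u => (u *m c) 0 0) MN.
by rewrite -mulmxA mul0mx mulmxBl !mxE.
Qed.
End AffineSemigroup.

Lemma monalgEZ (M : conomType) (R : comNzRingType) (g : {malg R[M]}) :
  g = \sum_(m <- msupp g) g@_m *: << m >>.
Proof.
rewrite [LHS]monalgE; apply: eq_bigr => m _; apply/malgP => x.
by rewrite mcoeffZ !mcoeffU mulrnAr mulr1.
Qed.

(** * Homogeneous classes in an associated graded module *)

Section GrIn.
Variables (K : fieldType) (R : comAlgType K) (F : filtration R) (k : rat).

Lemma fil_val_linear c (u v : fil_part F k) :
  val (c *: u + v) = c *: val u + val v.
Proof. exact: linearP. Qed.

Lemma gr_in_lt (u : fil_part F k) j :
  j < k -> val u \in fil F j -> gr_in (gr_cls u) = 0.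
Proof.
move=> jk uj; rewrite -(gr_in0 F k) -(raddf0 (@gr_cls _ _ F k)).
by congr gr_in; apply/gr_clsP/asboolP; exists j; rewrite ?subr0.
Qed.

Lemma gr_cls_repr (u : fil_part F k) :
  exists2 j, j < k & val (repr (gr_cls u)) - val u \in fil F j.
Proof.
have /gr_clsP/asboolP[j jk uj] := gr_clsK (gr_cls u).
by exists j => //; rewrite -raddfB.
Qed.

Lemma gr_in_sum (P : gr F -> Prop) (I : eqType) (r : seq I) (c : I -> K)
    (u : I -> fil_part F k) :
  P 0 -> (forall f g, P f -> P g -> P (f + g)) ->
  (forall a f, P f -> P (a *: f)) ->
  {in r, forall i, P (gr_in (gr_cls (u i)))} ->
  P (gr_in (gr_cls (\sum_(i <- r) c i *: u i))).
Proof.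
move=> P0 PD PZ Pu; rewrite big_seq; elim/big_ind: _ => [|v w Pv Pw|i /Pu ui].
- by rewrite raddf0 gr_in0.
- by rewrite raddfD gr_inD; apply: PD.
- by rewrite gr_clsZ gr_inZ; apply: PZ.
Qed.

End GrIn.

(** * The isomorphism, given a degree [ell] on [H] and a section [s] of [phiA] by monomials of least
    weight *)

Section GradedIso.
Local Open Scope quotient_scope.
Variables (K : fieldType) (H : conomType) (A : {fset H}) (L : A -> rat).
Variables (ell : H -> rat) (s : H -> {cmonom A}).
Hypothesis phi_s : forall h, phiA (s h) = h.
Hypothesis wdeg_s : forall h, wdeg L (s h) = ell h.
Hypothesis ell_le : forall p, ell (phiA p) <= wdeg L p.
Hypothesis ellM : forall x y, ell (mmul x y) = ell x + ell y.

Local Notation S := {malg K[{cmonom A}]}.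
Local Notation I := (toric_ideal K A).
Local Notation Q := {ideal_quot I}.
Definition toric_filtration : filtration Q :=
  quot_filtration I (weight_filtration K L).
Local Notation F := toric_filtration.
Local Notation gr := (gr F).

Definition ymon (p : {cmonom A}) : S := << p >>.
Definition tmon (h : H) : {malg K[H]} := << h >>.

Lemma presentationE (g : S) (h : H) :
  (presentation K A g)@_h = \sum_(p <- msupp g) g@_p *+ (phiA p == h).
Proof.
rewrite /presentation mmapE raddf_sum; apply: eq_bigr => p _ /=.
by rewrite mcoeffCM mcoeffU mulrnAr mulr1.
Qed.

Lemma presentationZ c (g : S) :
  presentation K A (c *: g) = c *: presentation K A g.
Proof. by rewrite [LHS]mmapZ mul_malgC. Qed.

Lemma presentationB (f g : S) :
  presentation K A (f - g) = presentation K A f - presentation K A g.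
Proof. exact: (rmorphB (presentation K A)). Qed.

Lemma presentationU (p : {cmonom A}) :
  presentation K A (ymon p) = tmon (phiA p).
Proof. by rewrite [LHS]mmapU mul1r. Qed.

Definition quot_presentation (u : Q) : {malg K[H]} := presentation K A (repr u).

Lemma quot_presentation_pi (g : S) :
  quot_presentation (\pi_Q g) = presentation K A g.
Proof.
apply/eqP; rewrite -subr_eq0; apply/eqP.
have : repr (\pi_Q g) - g \in I by rewrite Quotient.idealrBE reprK.
by move/eqP => <-; rewrite presentationB.
Qed.

Lemma quot_presentation_linear c u v : quot_presentation (c *: u + v)
  = c *: quot_presentation u + quot_presentation v.
Proof.
rewrite -[u]reprK -[v]reprK -pi_scale -raddfD !quot_presentation_pi.
by rewrite -presentationZ; apply: (rmorphD (presentation K A)).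
Qed.

Lemma quot_presentationB u v :
  quot_presentation (u - v) = quot_presentation u - quot_presentation v.
Proof.
by rewrite addrC -scaleN1r quot_presentation_linear scaleN1r addrC.
Qed.

(** The binomial [ymon p - ymon q] lies in the toric ideal. *)
Lemma pi_monomial (p q : {cmonom A}) :
  phiA p = phiA q -> \pi_Q (ymon p) = \pi_Q (ymon q).
Proof.
move=> pq; apply/eqP; rewrite -Quotient.idealrBE; apply/eqP.
rewrite presentationB [X in X - _]presentationU [X in _ - X]presentationU.
by rewrite pq subrr.
Qed.

(** By [ell_le], a monomial of weight at most [k] maps to degree at most [k]. Hence the image
    filtration is contained in the degree filtration of K[H]. *)
Lemma quot_fil_coef k (u : Q) h :
  u \in fil F k -> k < ell h -> (quot_presentation u)@_h = 0.
Proof.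
move=> /asboolP[g /allP gk <-] kh; rewrite quot_presentation_pi presentationE.
rewrite big_seq big1 // => p /gk pk; case: eqP => // ph; move: kh.
by rewrite ltNge -ph (le_trans (ell_le p) pk).
Qed.

Lemma monomial_fil p k : wdeg L p <= k -> \pi_Q (ymon p) \in fil F k.
Proof.
move=> pk; apply/asboolP; exists (ymon p) => //; apply/allP => q.
by rewrite msuppU1 in_fset1 => /eqP->.
Qed.

Lemma section_fil h : \pi_Q (ymon (s h)) \in fil F (ell h).
Proof. by rewrite monomial_fil ?wdeg_s. Qed.

(** The element of [gr] that will correspond to the monomial of [h] in K[H]. *)
Definition gr_monomial h : gr := gr_in (gr_cls (FilPart (section_fil h))).

Lemma ymonM p q : ymon (mmul p q) = ymon p * ymon q.
Proof. by rewrite [RHS]fgmulUU mulr1. Qed.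

Lemma pi_sum_ymon g :
  \pi_Q g = \sum_(p <- msupp g) g@_p *: \pi_Q (ymon p).
Proof.
rewrite [in LHS](monalgEZ g) raddf_sum; apply: eq_bigr => p _.
exact: pi_scale.
Qed.

Lemma gr_monomialM x y : gr_monomial (mmul x y) = gr_monomial x * gr_monomial y.
Proof.
rewrite [RHS]gr_mul_in gr_part_mul_cls; apply: gr_in_eq; first exact: ellM.
rewrite /= -rmorphM -ymonM; apply: pi_monomial.
by rewrite phiAM !phi_s.
Qed.

Lemma gr_monomial1 : gr_monomial mone = 1.
Proof.
apply: gr_in_eq; first by apply: (addrI (ell mone)); rewrite -ellM mul1m addr0.
by rewrite /= -(rmorph1 \pi_Q); apply: pi_monomial; rewrite phi_s phiA1.
Qed.

(** The classes [gr_monomial h] span [gr]: a monomial of weight at most [k] has class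
    [gr_monomial (phiA p)] in degree [k] if [ell (phiA p) = k], and class 0 otherwise. *)
Lemma gr_monomial_ind (P : gr -> Prop) :
  P 0 -> (forall f g, P f -> P g -> P (f + g)) ->
  (forall c f, P f -> P (c *: f)) -> (forall h, P (gr_monomial h)) ->
  forall f, P f.
Proof.
move=> P0 PD PZ PM; apply: gr_ind => // k u.
have /asboolP[g /allP gk gu] := valP u.
(* The default 0 does not occur on the support of [g], whose monomials have weight at most [k]. *)
pose part p := insubd (0 : fil_part F k) (\pi_Q (ymon p)).
have partE p : wdeg L p <= k -> val (part p) = \pi_Q (ymon p).
  by move=> pk; rewrite insubdK // monomial_fil.
have -> : u = \sum_(p <- msupp g) g@_p *: part p.
  apply: val_inj; rewrite -gu pi_sum_ymon [RHS]raddf_sum.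
  apply: eq_big_seq => p /gk pk; rewrite [RHS]linearZ.
  by congr (_ *: _); apply: esym (partE p pk).
apply: gr_in_sum => // p /gk pk.
have part_s : val (part p) = \pi_Q (ymon (s (phiA p))).
  exact: etrans (partE p pk) (pi_monomial (esym (phi_s _))).
have [pE|/negPf pk'] := eqVneq (ell (phiA p)) k.
  have -> : gr_in (gr_cls (part p)) = gr_monomial (phiA p) by exact: gr_in_eq.
  exact: PM.
(* [y^p] agrees in the quotient with a monomial of weight [ell (phi p) < k]. *)
rewrite (@gr_in_lt _ _ F k _ (ell (phiA p))) //.
  by rewrite lt_neqAle pk' (le_trans (ell_le p) pk).
by rewrite [X in X \in _]part_s section_fil.
Qed.

(** * Evaluation of homogeneous classes in K[H] graded by [ell] *)

Definition hcomp k (g : {malg K[H]}) : {malg K[H]} :=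
  \sum_(h <- msupp g | ell h == k) g@_h *: tmon h.

Lemma hcompE k g h : (hcomp k g)@_h = g@_h *+ (ell h == k).
Proof.
rewrite /hcomp raddf_sum /=.
under eq_bigr => x _ do rewrite mcoeffZ mcoeffU1.
have [hg|hg] := boolP (h \in msupp g); last first.
  rewrite mcoeff_outdom // mul0rn big_seq_cond big1 // => x /andP[xg _].
  by case: eqP => [xh|]; rewrite ?mulr0 //; rewrite -xh xg in hg.
rewrite -big_filter; case: (ell h == k) / eqP => hk.
  rewrite (bigD1_seq h) ?mem_filter ?hk ?eqxx ?filter_uniq //= mulr1.
  by rewrite big1 ?addr0 // => x xh; rewrite (negPf xh) mulr0.
rewrite big_seq big1 // => x; rewrite mem_filter => /andP[/eqP xk _].
by case: eqP => [xh|]; rewrite ?mulr0 //; rewrite -xh in hk.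
Qed.

Lemma hcomp_linear k c f g : hcomp k (c *: f + g) = c *: hcomp k f + hcomp k g.
Proof.
apply/malgP => h.
by rewrite mcoeffD mcoeffZ !hcompE mcoeffD mcoeffZ mulrnDl mulrnAr.
Qed.

Lemma hcomp_eq k f g :
  (forall h, ell h = k -> f@_h = g@_h) -> hcomp k f = hcomp k g.
Proof.
by move=> fg; apply/malgP => h; rewrite !hcompE; case: eqP => // /fg->.
Qed.

Definition gr_eval_part k (u : gr_part F k) : {malg K[H]} :=
  hcomp k (quot_presentation (val (repr u))).

(** Two representatives differ by an element of a smaller filtration step, which has no coefficient
    in degree [k]. *)
Lemma gr_eval_part_cls k (u : fil_part F k) :
  gr_eval_part (gr_cls u) = hcomp k (quot_presentation (val u)).
Proof.
have [j jk uj] := gr_cls_repr u.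
apply: hcomp_eq => h hk; apply/eqP; rewrite -subr_eq0 -mcoeffB.
by rewrite -quot_presentationB (quot_fil_coef uj) ?hk.
Qed.

Lemma gr_eval_part_linear k c (u v : gr_part F k) :
  gr_eval_part (c *: u + v) = c *: gr_eval_part u + gr_eval_part v.
Proof.
rewrite -[u]gr_clsK -[v]gr_clsK -gr_clsZ -raddfD !gr_eval_part_cls.
by rewrite fil_val_linear quot_presentation_linear hcomp_linear.
Qed.

Lemma gr_eval_part0 k : gr_eval_part (0 : gr_part F k) = 0.
Proof.
have := gr_eval_part_linear (-1) (0 : gr_part F k) 0.
by rewrite scaler0 addr0 scaleN1r addNr.
Qed.

Definition gr_eval (f : gr) : {malg K[H]} :=
  \sum_(k \in [set: rat]) gr_eval_part (f k).

Lemma gr_evalE (t : {fset rat}) (f : gr) :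
  (forall k, k \notin t -> f k = 0) ->
  gr_eval f = \sum_(k <- t) gr_eval_part (f k).
Proof. by move=> ft; apply: fsbigTE => k /ft->; exact: gr_eval_part0. Qed.

Lemma gr_eval_linear : linear gr_eval.
Proof.
move=> c f g; have [t [ft gt]] := gr_finite2 f g.
rewrite (gr_evalE ft) (gr_evalE gt) (@gr_evalE t) => [|k kt]; last first.
  by rewrite gr_compD gr_compZ ft // gt // scaler0 addr0.
rewrite scaler_sumr -big_split; apply: eq_bigr => k _.
by rewrite gr_compD gr_compZ gr_eval_part_linear.
Qed.

HB.instance Definition _ :=
  GRing.isLinear.Build K gr {malg K[H]} _ gr_eval gr_eval_linear.

Lemma gr_eval_monomial h : gr_eval (gr_monomial h) = tmon h.
Proof.
rewrite (@gr_evalE [fset (ell h)]%fset) => [|k]; last first.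
  by rewrite in_fset1 => kh; rewrite gr_in_out // eq_sym.
rewrite big_seq_fset1 gr_inE gr_eval_part_cls /= quot_presentation_pi.
rewrite presentationU phi_s; apply/malgP => x; rewrite hcompE mcoeffU1.
by case: eqP => [->|_]; rewrite ?eqxx ?mul0rn.
Qed.

(** * The inverse map and multiplicativity *)

Definition gr_lift (g : {malg K[H]}) : gr :=
  \sum_(h <- msupp g) g@_h *: gr_monomial h.

Lemma gr_liftEw (d : {fset H}) g : (msupp g `<=` d)%fset ->
  gr_lift g = \sum_(h <- d) g@_h *: gr_monomial h.
Proof.
move=> gd; rewrite /gr_lift (big_fset_incl _ gd) // => h _ hg.
by rewrite mcoeff_outdom ?scale0r.
Qed.

Lemma gr_lift_linear : linear gr_lift.
Proof.
move=> c f g; pose d := (msupp f `|` msupp g)%fset.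
rewrite (@gr_liftEw d f) ?fsubsetUl // (@gr_liftEw d g) ?fsubsetUr //.
rewrite (@gr_liftEw d); last first.
  by rewrite (fsubset_trans (msuppD_le _ _)) ?fsetSU ?msuppZ_le.
rewrite scaler_sumr -big_split; apply: eq_bigr => h _.
by rewrite mcoeffD mcoeffZ scalerDl scalerA.
Qed.

HB.instance Definition _ :=
  GRing.isLinear.Build K {malg K[H]} gr _ gr_lift gr_lift_linear.

Lemma gr_lift_tmon h : gr_lift (tmon h) = gr_monomial h.
Proof. by rewrite /gr_lift msuppU1 big_seq_fset1 mcoeffU1 eqxx scale1r. Qed.

(** Both maps are linear and the classes [gr_monomial h] span [gr], so it suffices to compare on
    them. *)
Lemma gr_evalK : cancel gr_eval gr_lift.
Proof.
elim/gr_monomial_ind => [|f g fK gK|c f fK|h]; first by rewrite !linear0.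
- rewrite (linearD gr_eval) (linearD gr_lift).
  exact: (f_equal2 +%R fK gK).
- by rewrite !linearZ /= fK.
- by rewrite gr_eval_monomial gr_lift_tmon.
Qed.

Lemma gr_liftK : cancel gr_lift gr_eval.
Proof.
move=> g; rewrite /gr_lift linear_sum [RHS]monalgEZ.
by apply: eq_bigr => h _; rewrite linearZ /= gr_eval_monomial.
Qed.

(** By bilinearity the product need only be checked on pairs of classes [gr_monomial x],
    [gr_monomial y]. *)
Lemma gr_eval_monoid : monoid_morphism gr_eval.
Proof.
split=> [|f g]; first by rewrite -gr_monomial1 gr_eval_monomial.
elim/gr_monomial_ind: f => [|f f' IHf IHf'|c f IHf|x].
- by rewrite mul0r linear0 mul0r.
- by rewrite mulrDl !linearD /= IHf IHf' mulrDl.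
- by rewrite -gr_scaleAl !linearZ /= IHf -scalerAl.
elim/gr_monomial_ind: g => [|g g' IHg IHg'|c g IHg|y].
- by rewrite mulr0 linear0 mulr0.
- by rewrite mulrDr !linearD /= IHg IHg' mulrDr.
- by rewrite mulrC -gr_scaleAl !linearZ /= mulrC IHg -scalerAr.
rewrite -gr_monomialM !gr_eval_monomial.
by rewrite [RHS]fgmulUU mulr1.
Qed.

Lemma gr_toric_iso : exists f : {linear gr -> {malg K[H]}},
  monoid_morphism f /\ bijective f.
Proof.
exists gr_eval; split; first exact: gr_eval_monoid.
by exists gr_lift; [apply: gr_evalK | apply: gr_liftK].
Qed.

End GradedIso.

(** * Choice of the weight vector *)

Theorem proposition4p5 (K : fieldType) (H : conomType) (A : {fset H}) :
  affine_semigroup H -> generates A ->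
  exists L : A -> rat, (forall a, 0 < L a) /\
    exists f : {linear gr (quot_filtration (toric_ideal K A)
                                           (weight_filtration K L))
                       -> {malg K[H]}},
      monoid_morphism f /\ bijective f.
Proof.
move=> Haff Agen.
have [lam [lam_gt0 lamE]] := positive_grading A (affine_cancel Haff).
have [s sP] := choice (fun h => phiA_surj h Agen).
have phi_s h : phiA (s h) = h by have [] := sP h.
(* Here [ucm a] and the empty monomial lie over the same element, so their [lam]-weights agree. *)
have lam1 (a : A) : val a = mone -> lam a = 0.
  move=> a1; have := lamE (ucm a) mone; rewrite phiAU phiA1 wdeg1 => /(_ a1).
  rewrite /wdeg (bigD1 a) //= cmUU big1 ?addr0 // => b ba.
  by rewrite cmU eq_sym (negPf ba).
pose L (a : A) := if val a == mone then 1 else lam a.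
exists L; split=> [a|]; first by rewrite /L; case: ifPn => // /lam_gt0.
(* The degree is the [lam]-weight of any monomial over [h]. It equals the [L]-weight on [s h], which
   avoids the generator 1, and is at most the [L]-weight elsewhere since [lam] is bounded by [L]. *)
apply: (@gr_toric_iso K H A L (fun h => wdeg lam (s h)) s) => [//|h|p|x y].
- apply: eq_bigr => a _; rewrite /L; case: eqP => // a1.
  by have [_ /(_ a a1)->] := sP h.
- rewrite (lamE _ p) //; apply: ler_sum => a _; apply: ler_wMn2r.
  by rewrite /L; case: eqP => // /lam1->; apply: ler01.
- by rewrite -wdegM; apply: lamE; rewrite phiAM !phi_s.
Qed.
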